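(* Let $\mathcal{A}$ and $\mathcal{B}$ be $C^*$-algebras with regular monotone completions $\overline{\mathcal{A}}$ and $\overline{\mathcal{B}}$, and suppose $\Phi:\mathcal{A}^{sa}\to\mathcal{B}^{sa}$ is an order isomorphism. Then there exists a unique order isomorphism $\overline{\Phi}:\overline{\mathcal{A}}^{sa}\to\overline{\mathcal{B}}^{sa}$ extending $\Phi$.
   Context: All $C^*$-algebras are unital; $\mathcal{A}^{sa}$ is the self-adjoint part with order $a\le b\iff b-a$ positive. An order isomorphism is a bijection preserving order in both directions. A $C^*$-algebra is monotone complete if every bounded increasing net of self-adjoint elements has a supremum in the self-adjoint part. A regular monotone completion of $\mathcal{A}$ is a monotone complete $C^*$-algebra $\overline{\mathcal{A}}$ containing $\mathcal{A}$ as a unital $C^*$-subalgebra (via a unital $^*$-monomorphism) such that $\overline{\mathcal{A}}^{sa}$ is the monotone closure of $\mathcal{A}^{sa}$ in $\overline{\mathcal{A}}^{sa}$ (the smallest subset containing $\mathcal{A}^{sa}$ and closed under suprema/infima, taken in $\overline{\mathcal{A}}^{sa}$, of bounded increasing/decreasing nets), every $b\in\overline{\mathcal{A}}^{sa}$ is the supremum in $\overline{\mathcal{A}}^{sa}$ of $\{a\in\mathcal{A}^{sa}:a\le b\}$, and suprema existing in $\mathcal{A}^{sa}$ remain suprema in $\overline{\mathcal{A}}^{sa}$. Such a completion exists and is unique up to a $^*$-isomorphism fixing $\mathcal{A}$ (Hamana). *)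

(* Defs.v *)
From mathcomp Require Import all_boot all_order all_algebra.
From mathcomp Require Import reals complex.
Set Implicit Arguments. Unset Strict Implicit. Unset Printing Implicit Defensive.
Import Order.TTheory GRing.Theory Num.Theory.
Local Open Scope ring_scope.

Section CStar.
Variable R : realType.

Definition is_cstar (A : algType R[i]) (star : A -> A) (nrm : A -> R) : Prop :=
  [/\
      [/\ (forall x, star (star x) = x),
          (forall x y, star (x + y) = star x + star y),
          (forall (c : R[i]) x, star (c *: x) = conjc c *: star x)
        & (forall x y, star (x * y) = star y * star x)],
      [/\ (forall x, 0 <= nrm x) /\ (forall x, nrm x = 0 -> x = 0),
          (forall x y, nrm (x + y) <= nrm x + nrm y),
          (forall (c : R[i]) x, nrm (c *: x) = Normc.normc c * nrm x)
        & (forall x y, nrm (x * y) <= nrm x * nrm y)],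
      (forall x, nrm (star x * x) = nrm x ^+ 2)
    &
      (forall u : nat -> A,
         (forall e : R, 0 < e -> exists N, forall m n, (N <= m)%N -> (N <= n)%N ->
              nrm (u m - u n) < e) ->
         exists l, forall e : R, 0 < e -> exists N, forall n, (N <= n)%N ->
              nrm (u n - l) < e)].

Variable A : algType R[i].
Variable star : A -> A.

Definition selfadj (x : A) : Prop := star x = x.
Definition positive (x : A) : Prop := exists y, x = star y * y.
Definition le_sa (x y : A) : Prop := positive (y - x).

Definition Sa := {x : A | star x = x}.

Definition is_sup (S : A -> Prop) (s : A) : Prop :=
  [/\ selfadj s, (forall x, S x -> le_sa x s) &
      (forall u, selfadj u -> (forall x, S x -> le_sa x u) -> le_sa s u)].
Definition is_inf (S : A -> Prop) (s : A) : Prop :=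
  [/\ selfadj s, (forall x, S x -> le_sa s x) &
      (forall u, selfadj u -> (forall x, S x -> le_sa u x) -> le_sa u s)].

Definition directed_set (D : Type) (leD : D -> D -> Prop) : Prop :=
  [/\ inhabited D, (forall i, leD i i), (forall i j k, leD i j -> leD j k -> leD i k)
    & (forall i j, exists k, leD i k /\ leD j k)].

Definition bounded_sa_net (D : Type) (x : D -> A) : Prop :=
  (forall i, selfadj (x i)) /\
  exists c, selfadj c /\ forall i, le_sa (- c) (x i) /\ le_sa (x i) c.

Definition incr_bounded_net (D : Type) (leD : D -> D -> Prop) (x : D -> A) : Prop :=
  [/\ directed_set leD, bounded_sa_net x & forall i j, leD i j -> le_sa (x i) (x j)].
Definition decr_bounded_net (D : Type) (leD : D -> D -> Prop) (x : D -> A) : Prop :=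
  [/\ directed_set leD, bounded_sa_net x & forall i j, leD i j -> le_sa (x j) (x i)].

Definition range_net (D : Type) (x : D -> A) : A -> Prop := fun y => exists i, y = x i.

Definition monotone_complete : Prop :=
  forall (D : Type) (leD : D -> D -> Prop) (x : D -> A),
    incr_bounded_net leD x -> exists s, is_sup (range_net x) s.

Definition mono_closed (S : A -> Prop) : Prop :=
  (forall (D : Type) (leD : D -> D -> Prop) (x : D -> A),
     incr_bounded_net leD x -> (forall i, S (x i)) ->
     forall s, is_sup (range_net x) s -> S s) /\
  (forall (D : Type) (leD : D -> D -> Prop) (x : D -> A),
     decr_bounded_net leD x -> (forall i, S (x i)) ->
     forall s, is_inf (range_net x) s -> S s).

Definition monotone_closure (S0 : A -> Prop) (x : A) : Prop :=
  forall S : A -> Prop, (forall y, S0 y -> S y) -> mono_closed S -> S x.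

End CStar.

Definition order_iso (R : realType) (A B : algType R[i]) (starA : A -> A) (starB : B -> B)
    (f : Sa starA -> Sa starB) : Prop :=
  bijective f /\
  forall x y : Sa starA, le_sa starA (proj1_sig x) (proj1_sig y) <-> le_sa starB (proj1_sig (f x)) (proj1_sig (f y)).

Definition unital_star_mono (R : realType) (A B : algType R[i])
    (starA : A -> A) (starB : B -> B) (i : A -> B) : Prop :=
  [/\ injective i,
      (forall (c : R[i]) x y, i (c *: x + y) = c *: i x + i y),
      (forall x y, i (x * y) = i x * i y),
      i 1 = 1
    & forall x, i (starA x) = starB (i x)].

Definition regular_monotone_completion (R : realType) (A : algType R[i]) (starA : A -> A)
    (Ab : algType R[i]) (starAb : Ab -> Ab) (nAb : Ab -> R) (iA : A -> Ab) : Prop :=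
  [/\ is_cstar starAb nAb /\ monotone_complete starAb,
      unital_star_mono starA starAb iA,
      (forall x, selfadj starAb x ->
         monotone_closure starAb (fun y => exists a, selfadj starA a /\ y = iA a) x),
      (forall b, selfadj starAb b ->
         is_sup starAb (fun y => exists a, [/\ selfadj starA a, y = iA a & le_sa starAb (iA a) b]) b)
    &
      (forall (S : A -> Prop) (s : A), (forall a, S a -> selfadj starA a) ->
         is_sup starA S s -> is_sup starAb (fun y => exists a, S a /\ y = iA a) (iA s))].

Definition extends (R : realType) (A B Ab Bb : algType R[i])
    (starA : A -> A) (starB : B -> B) (starAb : Ab -> Ab) (starBb : Bb -> Bb)
    (iA : A -> Ab) (iB : B -> Bb)
    (Phi : Sa starA -> Sa starB) (Phib : Sa starAb -> Sa starBb) : Prop :=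
  forall (a : Sa starA) (b : Sa starAb), proj1_sig b = iA (proj1_sig a) -> proj1_sig (Phib b) = iB (proj1_sig (Phi a)).

(* Main.v *)
(* Every element of the completion is both a supremum and an infimum of elements
   of [A], so the completion embeds in the complete lattice of cuts of [A^sa].
   Bounded monotone suprema and infima of the completion are those of the lattice
   of cuts, so the completion is the least set of cuts containing [A] and closed
   under them, a description which [Phi] transports.

   That [<=] is a partial order, and is reflected by the embedding, rests on the
   positivity of [y* y] and the uniqueness of positive square roots.  These are
   obtained without spectral theory, from the criterion [|t - h| <= t]. *)

Require Import Defs.
From mathcomp Require Import all_boot all_order all_algebra.
From mathcomp Require Import reals complex.
From mathcomp Require Import boolp ring lra.

Set Implicit Arguments. Unset Strict Implicit. Unset Printing Implicit Defensive.

(** * Order completions *)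

Section OrderDense.

(** All notions below take the relation as a parameter, so that decreasing nets and infima are
    increasing nets and suprema for [flip le]. *)
Definition flip (T : Type) (le : T -> T -> Prop) (x y : T) : Prop := le y x.

Definition lub (T : Type) (le : T -> T -> Prop) (D : Type) (x : D -> T) (s : T) : Prop :=
  (forall j, le (x j) s) /\ (forall u, (forall j, le (x j) u) -> le s u).

Definition bounded_monotone (T : Type) (le : T -> T -> Prop)
    (D : Type) (leD : D -> D -> Prop) (x : D -> T) : Prop :=
  [/\ directed_set leD, (exists l u, forall j, le l (x j) /\ le (x j) u) &
      forall j k, leD j k -> le (x j) (x k)].

(** The order on [P] is left implicit: it is the one pulled back along [i]. Read for [flip leQ],
    [hc_dense] is density from above and [hc_cofinal] puts an element of the image below every
    [b]. *)
Record half_completion (P Q : Type) (leQ : Q -> Q -> Prop) (i : P -> Q) : Prop := {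
  hc_refl : forall b, leQ b b;
  hc_anti : forall b c, leQ b c -> leQ c b -> b = c;
  hc_trans : forall b c d, leQ b c -> leQ c d -> leQ b d;
  hc_dense : forall b c, (forall a, leQ (i a) b -> leQ (i a) c) -> leQ b c;
  hc_cofinal : forall b, exists a, leQ b (i a);
  hc_complete : forall (D : Type) (leD : D -> D -> Prop) (x : D -> Q),
    bounded_monotone leQ leD x -> exists s, lub leQ x s }.

Definition sup_closed (T : Type) (le : T -> T -> Prop) (S : T -> Prop) : Prop :=
  forall (D : Type) (leD : D -> D -> Prop) (x : D -> T),
    bounded_monotone le leD x -> (forall j, S (x j)) ->
    forall s, lub le x s -> S s.

Record order_completion (P Q : Type) (leQ : Q -> Q -> Prop) (i : P -> Q) : Prop := {
  oc_sup : half_completion leQ i;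
  oc_inf : half_completion (flip leQ) i;
  oc_gen : forall S : Q -> Prop, (forall a, S (i a)) ->
    sup_closed leQ S -> sup_closed (flip leQ) S -> forall b, S b }.

(** Equality of lower cuts. This relation is the graph of the extension to be built, and makes sense
    before each [b] is known to have a partner. *)
Definition same_cut (P Q Q' : Type) (leQ : Q -> Q -> Prop) (leQ' : Q' -> Q' -> Prop)
    (i : P -> Q) (i' : P -> Q') (b : Q) (c : Q') : Prop :=
  forall a, leQ (i a) b <-> leQ' (i' a) c.

Section Half.
Variables (P Q Q' : Type) (leQ : Q -> Q -> Prop) (leQ' : Q' -> Q' -> Prop).
Variables (i : P -> Q) (i' : P -> Q').
Hypothesis emb : forall a b, leQ (i a) (i b) <-> leQ' (i' a) (i' b).
Hypotheses (HQ : half_completion leQ i) (HQ' : half_completion leQ' i').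

Lemma same_cut_le b b' c c' : same_cut leQ leQ' i i' b c ->
  same_cut leQ leQ' i i' b' c' -> leQ b b' <-> leQ' c c'.
Proof.
move=> bc bc'; split=> h.
  by apply: (hc_dense HQ') => a /bc ab; apply/bc'; apply: (hc_trans HQ) ab h.
by apply: (hc_dense HQ) => a /bc ab; apply/bc'; apply: (hc_trans HQ') ab h.
Qed.

Lemma same_cut_image a : same_cut leQ leQ' i i' (i a) (i' a).
Proof. by move=> a'; exact: emb. Qed.

(** The upper cuts of [b] and [c] are read off by comparing them with the pairs [i a], [i' a], which
    themselves have equal lower cuts. *)
Lemma same_cut_flip b c : same_cut leQ leQ' i i' b c ->
  same_cut (flip leQ) (flip leQ') i i' b c.
Proof.
move=> bc a; rewrite /flip.
exact: same_cut_le bc (same_cut_image a).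
Qed.

End Half.

Section Sup.
Variables (P Q Q' : Type) (leQ : Q -> Q -> Prop) (leQ' : Q' -> Q' -> Prop).
Variables (i : P -> Q) (i' : P -> Q').
Hypothesis emb : forall a b, leQ (i a) (i b) <-> leQ' (i' a) (i' b).
Hypotheses (HQ : half_completion leQ i) (HQ' : half_completion leQ' i').
Hypotheses (HQf : half_completion (flip leQ) i) (HQf' : half_completion (flip leQ') i').

(** The upper cut of a supremum is the intersection of the upper cuts of the terms. So the supremum
    [d] of the partners has the upper cut of [s], and density from above turns this into equality of
    lower cuts. *)
Lemma sup_closed_same_cut : sup_closed leQ (fun b => exists c, same_cut leQ leQ' i i' b c).
Proof.
move=> D leD x [dirD [l [u lxu]] mono_x] ex_cut s [xs s_min].
have [y xy] := choice ex_cut.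
(* The bounds [l] and [u] may have no partner in [Q'], so they are replaced by bounds from the image
   of [P]. *)
have [al all] := hc_cofinal HQf l; have [au uau] := hc_cofinal HQ u.
have [|d [yd d_min]] := hc_complete HQ' (leD := leD) (x := y).
  split=> // [|j k jk]; last exact/(same_cut_le HQ HQ' (xy j) (xy k))/mono_x.
  exists (i' al), (i' au) => j; have [lj ju] := lxu j; split.
    by apply/xy; exact: (hc_trans HQ) all lj.
  apply/(same_cut_le HQ HQ' (xy j) (same_cut_image emb au)).
  exact: (hc_trans HQ) ju uau.
exists d.
suff sd : same_cut (flip leQ) (flip leQ') i i' s d.
  by apply: (same_cut_flip _ HQf HQf' sd) => a b; exact: emb.
move=> a; rewrite /flip; split=> h.
- apply: d_min => j.
  apply/(same_cut_le HQ HQ' (xy j) (same_cut_image emb a)).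
  exact: (hc_trans HQ) (xs j) h.
- apply: s_min => j.
  apply/(same_cut_le HQ HQ' (xy j) (same_cut_image emb a)).
  exact: (hc_trans HQ') (yd j) h.
Qed.

End Sup.

Section Extension.
Variables (P Q Q' : Type) (leQ : Q -> Q -> Prop) (leQ' : Q' -> Q' -> Prop).
Variables (i : P -> Q) (i' : P -> Q').
Hypothesis emb : forall a b, leQ (i a) (i b) <-> leQ' (i' a) (i' b).
Hypotheses (HQ : order_completion leQ i) (HQ' : order_completion leQ' i').

(** Induction along [oc_gen]: having a partner holds on the image of [P] and passes to bounded
    monotone suprema and, through [flip], to infima. *)
Lemma ex_same_cut b : exists c, same_cut leQ leQ' i i' b c.
Proof.
case: HQ HQ' => Qs Qi Qgen [Qs' Qi' _].
move: b; apply: Qgen => [a||].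
- by exists (i' a); exact: same_cut_image.
- exact: sup_closed_same_cut.
- move=> D leD x bx ex_cut s xs.
  have [c sc] : exists c, same_cut (flip leQ) (flip leQ') i i' s c.
    apply: (@sup_closed_same_cut _ _ _ (flip leQ) (flip leQ') i i') bx _ _ xs => //.
      by move=> a b; exact: emb.
    by move=> j; have [c jc] := ex_cut j; exists c; exact: same_cut_flip.
  exists c.
  by apply: (same_cut_flip _ Qi Qi' sc) => a b; exact: emb.
Qed.

End Extension.

Lemma half_completion_comp (P P' Q : Type) (leQ : Q -> Q -> Prop) (i : P -> Q) (f : P' -> P) :
  bijective f -> half_completion leQ i -> half_completion leQ (fun a => i (f a)).
Proof.
move=> [g fK gK] [r an tr dn cf cp]; split=> // [b c h|b].
  by apply: dn => a; rewrite -(gK a); exact: h.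
by have [a ba] := cf b; exists (g a); rewrite gK.
Qed.

(** Used with an order isomorphism [f], to regard a completion of its target as one of its
    source. *)
Lemma order_completion_comp (P P' Q : Type) (leQ : Q -> Q -> Prop) (i : P -> Q) (f : P' -> P) :
  bijective f -> order_completion leQ i -> order_completion leQ (fun a => i (f a)).
Proof.
move=> bf [os oi gen]; split; try exact: half_completion_comp.
move=> S Si; apply: gen => a; have [g _ gK] := bf.
by rewrite -(gK a); exact: Si.
Qed.

Lemma order_completion_unique (P Q Q' : Type) (leQ : Q -> Q -> Prop) (leQ' : Q' -> Q' -> Prop)
    (i : P -> Q) (i' : P -> Q') :
  (forall a b, leQ (i a) (i b) <-> leQ' (i' a) (i' b)) ->
  order_completion leQ i -> order_completion leQ' i' ->
  exists f : Q -> Q',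
    [/\ bijective f, (forall b c, leQ b c <-> leQ' (f b) (f c)), (forall a, f (i a) = i' a) &
        forall g : Q -> Q', (forall b c, leQ b c <-> leQ' (g b) (g c)) ->
          (forall a, g (i a) = i' a) -> g = f].
Proof.
move=> emb HQ HQ'.
have [f fP] := choice (ex_same_cut emb HQ HQ').
have [g gP] : {g & forall c, same_cut leQ' leQ i' i c (g c)}.
  by apply/choice/ex_same_cut => // a b; split=> /emb.
have [Qs _ _] := HQ; have [Qs' _ _] := HQ'.
have cut_inj b b' c : same_cut leQ leQ' i i' b c -> same_cut leQ leQ' i i' b' c -> b = b'.
  by move=> bc bc'; apply: (hc_anti Qs);
    [apply/(same_cut_le Qs Qs' bc bc') | apply/(same_cut_le Qs Qs' bc' bc)]; exact: hc_refl Qs' c.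
have cut_fun b c c' : same_cut leQ leQ' i i' b c -> same_cut leQ leQ' i i' b c' -> c = c'.
  move=> bc bc'; apply: (hc_anti Qs').
    exact/(same_cut_le Qs Qs' bc bc')/(hc_refl Qs).
  exact/(same_cut_le Qs Qs' bc' bc)/(hc_refl Qs).
have gP' c : same_cut leQ leQ' i i' (g c) c by move=> a; split=> /gP.
exists f; split.
- by exists g => [b|c]; [exact: cut_inj (gP' _) (fP b) | exact: cut_fun (fP _) (gP' c)].
- by move=> b c; exact: same_cut_le (fP b) (fP c).
- by move=> a; apply: cut_fun (fP _) _; exact: same_cut_image.
(* Since [h] reflects and preserves the order and agrees with [i'] on the image, [h b] has the cut
   of [b]. *)
- move=> h h_iso hi; apply/funext => b; apply: cut_fun (fP b) => a.
  by rewrite -hi.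
Qed.

End OrderDense.

(** * Positivity in C*-algebras *)

Section CStarPositive.
Import Order.TTheory GRing.Theory Num.Theory.
Local Open Scope ring_scope.
Local Open Scope complex_scope.

Variables (R : realType) (A : algType R[i]) (star : A -> A) (nrm : A -> R).
Hypothesis cs : is_cstar star nrm.

Local Notation scal t := (t%:C%:A : A).

(** * The involution and the norm *)

Lemma starK x : star (star x) = x. Proof. by case: cs => -[+ _ _ _] _ _ _; apply. Qed.
Lemma starD x y : star (x + y) = star x + star y.
Proof. by case: cs => -[_ + _ _] _ _ _; apply. Qed.
Lemma starZ c x : star (c *: x) = conjc c *: star x.
Proof. by case: cs => -[_ _ + _] _ _ _; apply. Qed.
Lemma starM x y : star (x * y) = star y * star x.
Proof. by case: cs => -[_ _ _ +] _ _ _; apply. Qed.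
Lemma star0 : star 0 = 0. Proof. by have := starZ 0 0; rewrite conjc0 !scale0r. Qed.
Lemma starN x : star (- x) = - star x.
Proof. by rewrite -scaleN1r starZ rmorphN1 scaleN1r. Qed.
Lemma starB x y : star (x - y) = star x - star y. Proof. by rewrite starD starN. Qed.
Lemma star1 : star 1 = 1.
Proof. by rewrite -{2}(starK 1) -{2}(mulr1 (star 1)) starM starK mulr1. Qed.
Lemma star_real t x : star x = x -> star (t%:C *: x) = t%:C *: x.
Proof. by move=> sx; rewrite starZ conjc_real sx. Qed.
Lemma star_scal t : star (scal t) = scal t. Proof. exact/star_real/star1. Qed.

Lemma nrm_ge0 x : 0 <= nrm x. Proof. by case: cs => _ [[+ _] _ _ _] _ _; apply. Qed.
Lemma nrm_eq0 x : nrm x = 0 -> x = 0. Proof. by case: cs => _ [[_ +] _ _ _] _ _; apply. Qed.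
Lemma nrmD x y : nrm (x + y) <= nrm x + nrm y.
Proof. by case: cs => _ [_ + _ _] _ _; apply. Qed.
Lemma nrmM x y : nrm (x * y) <= nrm x * nrm y.
Proof. by case: cs => _ [_ _ _ +] _ _; apply. Qed.
Lemma nrm_star_mul x : nrm (star x * x) = nrm x ^+ 2.
Proof. by case: cs => _ _ + _; apply. Qed.
Lemma nrmZ c x : nrm (c *: x) = Normc.normc c * nrm x.
Proof. by case: cs => _ [_ _ + _] _ _; apply. Qed.
Lemma nrmZr t x : nrm (t%:C *: x) = `|t| * nrm x.
Proof. by rewrite nrmZ /= expr0n addr0 sqrtr_sqr. Qed.
Lemma nrm0 : nrm 0 = 0. Proof. by have := nrmZr 0 0; rewrite scale0r normr0 mul0r. Qed.
Lemma nrmN x : nrm (- x) = nrm x.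
Proof. by have := nrmZr (-1) x; rewrite rmorphN1 scaleN1r normrN1 mul1r. Qed.
Lemma nrmBC x y : nrm (x - y) = nrm (y - x). Proof. by rewrite -nrmN opprB. Qed.
Lemma nrmB x y : nrm (x - y) <= nrm x + nrm y. Proof. by rewrite -(nrmN y) nrmD. Qed.
Lemma nrm_tri y x z : nrm (x - z) <= nrm (x - y) + nrm (y - z).
Proof. by rewrite -{1}(subrK y x) -addrA nrmD. Qed.
Lemma nrm_small x : (forall e, 0 < e -> nrm x <= e) -> x = 0.
Proof.
move=> h; apply: nrm_eq0; apply/le_anti; rewrite nrm_ge0 andbT.
by apply/ler_addgt0Pr => e /h; rewrite add0r.
Qed.
Lemma nrm1 : nrm 1 = 1.
Proof.
have n0 : nrm 1 != 0 by apply/eqP => /nrm_eq0/eqP; rewrite oner_eq0.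
by apply: (mulfI n0); rewrite mulr1 -expr2 -nrm_star_mul star1 mulr1.
Qed.
Lemma nrm_scal t : nrm (scal t) = `|t|. Proof. by rewrite nrmZr nrm1 mulr1. Qed.
Lemma nrm_star x : nrm (star x) = nrm x.
Proof.
have half y : nrm y <= nrm (star y).
  have := nrm_ge0 y; rewrite le_eqVlt => /orP[/eqP<-|y0]; first exact: nrm_ge0.
  by rewrite -(ler_pM2r y0) -expr2 -nrm_star_mul nrmM.
by apply/le_anti; rewrite half -{2}(starK x) half.
Qed.
Lemma nrm_sa_sq x : star x = x -> nrm (x * x) = nrm x ^+ 2.
Proof. by move=> {1}<-; exact: nrm_star_mul. Qed.

(** * Square roots of [1 - x] by iteration *)

Definition cvg (u : nat -> A) (l : A) : Prop :=
  forall e : R, 0 < e -> exists N, forall n, (N <= n)%N -> nrm (u n - l) < e.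

(** Carries self-adjointness and commutation relations over to the limit of the iteration, each
    being the vanishing of a bounded additive map. *)
Lemma cvg_kernel (f : A -> A) (C : R) (u : nat -> A) (l : A) :
  (forall x y, f (x - y) = f x - f y) -> (forall x, nrm (f x) <= C * nrm x) ->
  cvg u l -> (forall n, f (u n) = 0) -> f l = 0.
Proof.
move=> fB fC ul fu; apply: nrm_small => e e0.
(* [C] may be zero or negative, while [e] has to be divided by a positive bound. *)
have C0 : 0 < `|C| + 1 by rewrite ltr_wpDl.
have [N /(_ N (leqnn _)) uN] := ul _ (divr_gt0 e0 C0).
have -> : f l = - f (u N - l) by rewrite fB fu sub0r opprK.
rewrite nrmN (le_trans (fC _)) //.
rewrite (le_trans (ler_wpM2r (nrm_ge0 _) (_ : C <= `|C| + 1))) //.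
  by rewrite (le_trans (ler_norm _)) // lerDl.
by rewrite -ler_pdivlMl // mulrC ltW.
Qed.

(* A fixed point [y] of [y = (x + y^2) / 2] satisfies [(1 - y)^2 = 1 - x]. *)
Fixpoint sqrt_iter (x : A) (n : nat) : A :=
  if n is m.+1 then (2^-1)%:C *: (x + sqrt_iter x m * sqrt_iter x m) else 0.

Fixpoint sqrt_bound (n : nat) : R :=
  if n is m.+1 then 2^-1 * (1 + sqrt_bound m * sqrt_bound m) else 0.

Lemma sqrt_bound_itv n : 0 <= sqrt_bound n <= 1.
Proof. by elim: n => [|n /andP[h0 h1]] /=; [rewrite lexx ler01 | apply/andP; split; nra]. Qed.

Lemma sqrt_bound_le m n : (m <= n)%N -> sqrt_bound m <= sqrt_bound n.
Proof.
apply: (homo_leq (@lexx _ _) (@le_trans _ _)) => k.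
by have /andP[] := sqrt_bound_itv k; rewrite /=; nra.
Qed.

(** The sequence increases and stays below 1; [N] is the index of a term within [e] of its
    supremum. *)
Lemma sqrt_bound_cauchy e : 0 < e ->
  exists N, forall m n, (N <= m)%N -> (N <= n)%N -> sqrt_bound m - sqrt_bound n < e.
Proof.
move=> e0.
pose E : classical_sets.set R := fun t => exists n, t = sqrt_bound n.
have ubE : classical_sets.has_ubound E.
  by exists 1 => _ [n ->]; case/andP: (sqrt_bound_itv n).
have supE : classical_sets.has_sup E by split => //; exists (sqrt_bound 0), 0%N.
have [_ [N ->] hN] := sup_adherent e0 supE.
exists N => m n _ /sqrt_bound_le Nn.
have : sqrt_bound m <= sup E by apply: (ub_le_sup ubE); exists m.
lra.
Qed.

Section SqrtIter.
Variable x : A.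
Hypotheses (sx : star x = x) (x1 : nrm x <= 1).

Local Notation y := (sqrt_iter x).

Lemma star_sqrt_iter n : star (y n) = y n.
Proof. by elim: n => [|n IH] /=; [exact: star0 | rewrite star_real // starD starM IH sx]. Qed.

Lemma comm_sqrt_iter z n : z * x = x * z -> z * y n = y n * z.
Proof.
move=> zx; elim: n => [|n IH] /=; first by rewrite mulr0 mul0r.
by rewrite -scalerAr -scalerAl mulrDr mulrDl zx mulrA IH -!mulrA IH.
Qed.

Lemma nrm_half (z : A) : nrm ((2^-1)%:C *: z) = 2^-1 * nrm z.
Proof. by rewrite nrmZr ger0_norm // invr_ge0. Qed.

Lemma nrm_sqrt_iter n : nrm (y n) <= sqrt_bound n.
Proof.
elim: n => [|n IH] /=; first by rewrite nrm0.
rewrite nrm_half ler_pM2l ?invr_gt0 // (le_trans (nrmD _ _)) // lerD //.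
by rewrite (le_trans (nrmM _ _)) // ler_pM ?nrm_ge0.
Qed.

Lemma nrm_sqB (a b : A) : nrm (a * a - b * b) <= (nrm a + nrm b) * nrm (a - b).
Proof.
have -> : a * a - b * b = a * (a - b) + (a - b) * b by rewrite mulrBr mulrBl addrA subrK.
by rewrite (le_trans (nrmD _ _)) // [leRHS]mulrDl [nrm b * _]mulrC lerD ?nrmM.
Qed.

(* The scalar iteration at [x = 1] majorizes [sqrt_iter x]. *)
Lemma nrm_sqrt_iterS n : nrm (y n.+1 - y n) <= sqrt_bound n.+1 - sqrt_bound n.
Proof.
elim: n => [|n IH]; first by rewrite [y 0]/= !subr0 nrm_sqrt_iter.
have yS k : y k.+1 = (2^-1)%:C *: (x + y k * y k) by [].
have tS k : sqrt_bound k.+1 = 2^-1 * (1 + sqrt_bound k * sqrt_bound k) by [].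
have -> : y n.+2 - y n.+1 = (2^-1)%:C *: (y n.+1 * y n.+1 - y n * y n).
  by rewrite 2!yS -scalerBr opprD addrACA subrr add0r.
have -> : sqrt_bound n.+2 - sqrt_bound n.+1 =
    2^-1 * ((sqrt_bound n.+1 + sqrt_bound n) * (sqrt_bound n.+1 - sqrt_bound n)).
  by rewrite (tS n.+1) {3}(tS n); ring.
rewrite nrm_half ler_pM2l ?invr_gt0 //.
rewrite (le_trans (nrm_sqB _ _)) //.
by rewrite ler_pM ?addr_ge0 ?nrm_ge0 // lerD ?nrm_sqrt_iter.
Qed.

Lemma nrm_sqrt_iterB m n : (n <= m)%N -> nrm (y m - y n) <= sqrt_bound m - sqrt_bound n.
Proof.
elim: m => [|m IH]; first by rewrite leqn0 => /eqP->; rewrite !subrr nrm0.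
rewrite leq_eqVlt ltnS => /orP[/eqP->|/IH h]; first by rewrite !subrr nrm0.
rewrite (le_trans (nrm_tri (y m) _ _)) //.
by have := nrm_sqrt_iterS m; lra.
Qed.

Lemma sqrt_iter_cvg : exists l, cvg y l.
Proof.
case: cs => _ _ _; apply => e e0.
have [N hN] := sqrt_bound_cauchy e0.
exists N => m n Nm Nn; case: (leqP n m) => [nm|/ltnW nm].
  by rewrite (le_lt_trans (nrm_sqrt_iterB nm)) // hN.
by rewrite nrmBC (le_lt_trans (nrm_sqrt_iterB nm)) // hN.
Qed.

Lemma sqrt_one_sub : exists l, [/\ star l = l, nrm l <= 1, (1 - l) * (1 - l) = 1 - x &
  forall z, z * x = x * z -> z * l = l * z].
Proof.
have [l yl] := sqrt_iter_cvg; exists l.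
have l1 : nrm l <= 1.
  apply/ler_addgt0Pr => e e0; have [N /(_ N (leqnn _)) uN] := yl e e0.
  rewrite -[l](subrK (y N)) addrC (le_trans (nrmD _ _)) // lerD //.
    by rewrite (le_trans (nrm_sqrt_iter N)) //; case/andP: (sqrt_bound_itv N).
  by rewrite nrmBC ltW.
split=> //.
- apply/eqP; rewrite -subr_eq0; apply/eqP.
  apply: (@cvg_kernel (fun z => star z - z) 2 _ _ _ _ yl) => [a b|a|n].
  + by rewrite starB !opprD addrACA.
  + by rewrite (le_trans (nrmB _ _)) // nrm_star; lra.
  + by rewrite star_sqrt_iter subrr.
(* The fixed point equation [l = (x + l^2) / 2], cleared of its denominator. *)
- suff /eqP h : l + l - (x + l * l) = 0.
    rewrite subr_eq0 in h; rewrite mulrBl mul1r mulrBr mulr1 opprB -addrA; congr (1 + _).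
    rewrite -[l * l](addKr x) -(eqP h).
    by rewrite [- x + _]addrC -!addrA addKr addrCA subrr addr0.
  apply: nrm_small => e e0.
  (* Two terms [l - y N.+1] cost [e / 4] each, and the difference of squares at most
     [(1 + 1) * (e / 4)]. *)
  have e4 : 0 < e / 4 by rewrite divr_gt0.
  have [N hN] := yl _ e4.
  have uN := hN _ (leqnn N); have uN1 := hN _ (leqnSn N).
  have -> : l + l - (x + l * l) = (l - y N.+1) + (l - y N.+1) + (y N * y N - l * l).
    have : y N.+1 + y N.+1 = x + y N * y N.
      rewrite /= -scalerDl -rmorphD (_ : 2^-1 + 2^-1 = 1 :> R) ?scale1r //.
      by field.
    move=> h; rewrite (addrACA l (- y N.+1)) -opprD h -!addrA; do 2!congr (_ + _).
    by rewrite !opprD -addrA addKr.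
  rewrite (le_trans (nrmD _ _)) //.
  have h1 := nrmD (l - y N.+1) (l - y N.+1).
  have h2 := nrm_sqB (y N) l.
  rewrite nrmBC in uN1.
  have h3 : nrm (y N) <= 1.
    by rewrite (le_trans (nrm_sqrt_iter N)) //; case/andP: (sqrt_bound_itv N).
  have := nrm_ge0 (y N - l).
  nra.
- move=> z zx; apply/eqP; rewrite -subr_eq0; apply/eqP.
  apply: (@cvg_kernel (fun v => z * v - v * z) (nrm z + nrm z) _ _ _ _ yl) => [a b|a|n].
  + by rewrite mulrBr mulrBl !opprD addrACA.
  + by rewrite (le_trans (nrmB _ _)) // [leRHS]mulrDl lerD ?nrmM // [leRHS]mulrC nrmM.
  + by rewrite comm_sqrt_iter ?subrr.
Qed.

End SqrtIter.

(* A spectrum-free form of [sigma h \subset [0, +oo[] that makes sums of positives evident. *)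
Definition psd (h : A) : Prop := star h = h /\ exists2 t, 0 <= t & nrm (scal t - h) <= t.

(** * Sums, multiples and square roots of positive elements *)

Lemma scalD s t : scal (s + t) = scal s + scal t.
Proof. by rewrite rmorphD scalerDl. Qed.
Lemma scaleC s t (x : A) : s%:C *: (t%:C *: x) = (s * t)%:C *: x.
Proof. by rewrite scalerA -rmorphM. Qed.
Lemma scal_comm t (x : A) : x * scal t = scal t * x.
Proof. by rewrite mulr_algl mulr_algr. Qed.

Lemma psdD g h : psd g -> psd h -> psd (g + h).
Proof.
move=> [sg [s s0 gs]] [sh [t t0 ht]]; split; first by rewrite starD sg sh.
exists (s + t); first exact: addr_ge0.
by rewrite scalD opprD addrACA (le_trans (nrmD _ _)) // lerD.
Qed.

Lemma psdZ c h : 0 <= c -> psd h -> psd (c%:C *: h).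
Proof.
move=> c0 [sh [t t0 ht]]; split; first exact: star_real.
exists (c * t); first exact: mulr_ge0.
by rewrite -scaleC -scalerBr nrmZr ger0_norm // ler_wpM2l.
Qed.

Lemma psd_scalB b t : star b = b -> nrm b <= t -> psd (scal t - b).
Proof.
move=> sb bt; split; first by rewrite starB star_scal sb.
by exists t; [exact: le_trans (nrm_ge0 b) bt | rewrite subKr].
Qed.

(** For [t > 0] the criterion says that [h / t = 1 - x] with [nrm x <= 1], so the iteration applies
    and [r] is [sqrt t * (1 - l)]; for [t = 0] it forces [h = 0]. The commutation clause stands in
    for [r] being a limit of polynomials in [h]. *)
Lemma psd_sqrt h : psd h -> exists r, [/\ psd r, r * r = h &
  forall z, z * h = h * z -> z * r = r * z].
Proof.
move=> [sh [t t0 ht]]; have := t0; rewrite le_eqVlt => /orP[/eqP t00|tp].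
  have /nrm_eq0/eqP : nrm (scal t - h) = 0.
    by apply/le_anti; rewrite nrm_ge0 andbT [leRHS]t00.
  rewrite -t00 scale0r subr_eq0 => /eqP <-; exists 0; split=> [||z _].
  - by split; [exact: star0 | exists 0; rewrite // scale0r subr0 nrm0].
  - by rewrite mulr0.
  - by rewrite mulr0 mul0r.
pose x := 1 - t^-1%:C *: h.
have tV : t^-1 * t = 1 by rewrite mulVf // gt_eqF.
have xE : x = t^-1%:C *: (scal t - h) by rewrite scalerBr scaleC tV scale1r.
have sx : star x = x by rewrite xE star_real // starB star_scal sh.
have x1 : nrm x <= 1.
  by rewrite xE nrmZr ger0_norm ?invr_ge0 // ler_pdivrMl // mulr1.
have [l [sl l1 lE lz]] := sqrt_one_sub sx x1.
pose c := Num.sqrt t; have c0 : 0 <= c by exact: sqrtr_ge0.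
have cc : c * c = t by rewrite -expr2 sqr_sqrtr.
exists (c%:C *: (1 - l)); split.
- apply: psdZ => //; split; first by rewrite starB star1 sl.
  by exists 1; rewrite // scale1r subKr.
- by rewrite -scalerAl -scalerAr scaleC lE cc subKr scaleC mulrC tV scale1r.
- move=> z zh; rewrite -scalerAl -scalerAr mulrBr mulrBl mulr1 mul1r lz //.
  by rewrite mulrBr mulrBl mulr1 mul1r -scalerAl -scalerAr zh.
Qed.

Lemma conjc_i : conjc 'i = - 'i :> R[i].
Proof. by apply/eqP; rewrite eq_complex /= oppr0 !eqxx. Qed.

Lemma mulii : 'i * 'i = -1 :> R[i].
Proof. by rewrite -expr2 sqr_i. Qed.

(* If [c > 0] then [k + i l] is [sqrt c] times a unitary. *)
Lemma nrm_pythagoras k l c : star k = k -> star l = l -> k * l = l * k -> 0 <= c ->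
  k * k + l * l = scal c -> nrm k ^+ 2 <= c.
Proof.
move=> sk sl kl c0 klc; pose u : A := k + 'i *: l.
have su : star u = k - 'i *: l by rewrite starD starZ sk sl conjc_i scaleNr.
have uu : nrm u ^+ 2 = c.
  rewrite -nrm_star_mul su mulrBl mulrDr mulrDr -!scalerAl -!scalerAr scalerA kl.
  by rewrite opprD addrA addrK mulii scaleN1r opprK klc nrm_scal ger0_norm //.
rewrite -uu ler_sqr ?nnegrE ?nrm_ge0 //.
have : nrm (k + k) <= nrm u + nrm u.
  have -> : k + k = star u + u by rewrite su addrACA addNr addr0.
  by rewrite (le_trans (nrmD _ _)) // nrm_star.
have -> : k + k = 2%:C *: k by rewrite -[2]/(1 + 1) rmorphD scalerDl scale1r.
by rewrite nrmZr ger0_norm //; lra.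
Qed.

(** After scaling [k] to [k'] of norm at most 1, write [1 - k'^2] as [(1 - l)^2]. Then
    [(1 - l)^2 + k'^2 = 1] with commuting terms, so [nrm (1 - l) <= 1], and [1 - k'^2] has norm at
    most 1: the criterion with [t = 1]. *)
Lemma psd_sq k : star k = k -> psd (k * k).
Proof.
move=> sk; pose c := nrm k + 1.
have c0 : 0 < c by rewrite ltr_wpDl ?nrm_ge0.
pose k' := c^-1%:C *: k.
have sk' : star k' = k' by exact: star_real.
have k'1 : nrm k' <= 1.
  by rewrite nrmZr ger0_norm ?invr_ge0 ?(ltW c0) // ler_pdivrMl // mulr1 lerDl.
have sx : star (k' * k') = k' * k' by rewrite starM sk'.
have x1 : nrm (k' * k') <= 1.
  by rewrite nrm_sa_sq // expr_le1 ?nrm_ge0.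
have [l [sl l1 lE lz]] := sqrt_one_sub sx x1.
have sl' : star (1 - l) = 1 - l by rewrite starB star1 sl.
have k'l : (1 - l) * k' = k' * (1 - l).
  by rewrite mulrBr mulrBl mulr1 mul1r lz // mulrA.
have l2 : nrm (1 - l) ^+ 2 <= 1.
  by apply: (nrm_pythagoras sl' sk' k'l); rewrite // lE subrK scale1r.
have : psd (k' * k').
  by split=> //; exists 1; rewrite // scale1r -lE nrm_sa_sq.
move/(psdZ (sqr_ge0 c)).
rewrite -scalerAl -scalerAr !scaleC (_ : c ^+ 2 / c / c = 1) ?scale1r //.
by field; rewrite gt_eqF.
Qed.

(** The square roots [k] of [h] and [l] of [t - h] commute and satisfy [k^2 + l^2 = t], so
    [nrm_pythagoras] bounds [nrm h = nrm k ^+ 2]. *)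
Lemma psd_bound h t : 0 <= t -> psd h -> psd (scal t - h) -> nrm h <= t.
Proof.
move=> t0 /psd_sqrt[k [[sk _] kh kz]] /psd_sqrt[l [[sl _] lh lz]].
have kl : k * l = l * k.
  by apply: lz; rewrite mulrBr mulrBl scal_comm -kh mulrA.
by rewrite -kh nrm_sa_sq //; apply: (nrm_pythagoras sk sl kl); rewrite // kh lh addrC subrK.
Qed.

Lemma psd_anti h : psd h -> psd (- h) -> h = 0.
Proof.
move=> ph nh; apply/nrm_eq0/le_anti; rewrite nrm_ge0 andbT.
by apply: psd_bound => //; rewrite scale0r sub0r.
Qed.

(** Frees the criterion from its existential: any [t] above the norm is a witness. *)
Lemma psd_dist g t : psd g -> nrm g <= t -> nrm (scal t - g) <= t.
Proof.
move=> pg gt; have [sg _] := pg; apply: psd_bound; first exact: le_trans (nrm_ge0 g) gt.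
  exact: psd_scalB.
by rewrite subKr.
Qed.

(** Here [s] is the absolute value of [h], the root of [h^2]. *)
Lemma sa_abs h : star h = h -> exists s, [/\ psd s, s * s = h * h & h * s = s * h].
Proof.
move=> /psd_sq/psd_sqrt[s [ps sh sz]]; exists s; split=> //.
by apply: sz; rewrite mulrA.
Qed.

(** With [u] and [v] twice the real and, up to sign, the imaginary part of [z], the sum equals
    [(u^2 + v^2) / 2]. *)
Lemma psd_half_sum z : psd (z * star z + star z * z).
Proof.
pose u := z + star z; pose v : A := 'i *: (z - star z).
have su : star u = u by rewrite starD starK addrC.
have sv : star v = v.
  by rewrite starZ starB starK conjc_i scaleNr -scalerN opprB.
have := psdZ (c := 2^-1) _ (psdD (psd_sq su) (psd_sq sv)).
rewrite invr_ge0 ler0n => /(_ isT).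
suff -> : u * u + v * v = 2%:C *: (z * star z + star z * z).
  by rewrite scaleC mulVf ?scale1r // pnatr_eq0.
rewrite -scalerAl -scalerAr scalerA mulii scaleN1r.
rewrite mulrDl mulrBl opprB.
have acda (a b c d : A) : a + b + (c - d) = (a - d) + (b + c).
  by rewrite [c - d]addrC addrACA.
rewrite acda -mulrBr -mulrDr.
have -> : z + star z - (z - star z) = star z + star z by rewrite opprB addrC addrA subrK.
have -> : z + star z + (z - star z) = z + z by rewrite addrC [z + star z]addrC addrA subrK.
by rewrite !mulrDr addrACA -[2]/(1 + 1) rmorphD scalerDl scale1r.
Qed.

(** Only scalars and powers of [h] occur, so the identity is the image under evaluation at [h] of
    one between polynomials, where [ring] applies. *)
Lemma neg_star_mul_identity (h : A) t :
  scal (3 * t ^+ 3) - (5 * t ^+ 2)%:C *: h =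
  (scal (t ^+ 3) - (scal t + h) * h * (scal t + h)) +
  ((2 * t)%:C *: ((h - scal t) * (h - scal t)) + h * h * h).
Proof.
have [f [fX fC]] : exists f : {rmorphism {poly R[i]} -> A},
    f 'X = h /\ forall c, f c%:P = c%:A.
  exists (horner_alg h); split; first exact: horner_algX.
  by move=> c; exact: horner_algC.
pose T := (t%:C)%:P : {poly R[i]}.
have T3 : (t ^+ 3)%:C%:P = T ^+ 3 by rewrite /T -!rmorphXn.
have Tn n u : (n%:R * u)%:C%:P = n%:R * u%:C%:P :> {poly R[i]}.
  by rewrite !rmorphM /= !rmorph_nat.
have T33 : (3 * t ^+ 3)%:C%:P = 3 * T ^+ 3 by rewrite Tn T3.
have T52 : (5 * t ^+ 2)%:C%:P = 5 * T ^+ 2 by rewrite Tn /T -!rmorphXn.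
have T2 : (2 * t)%:C%:P = 2 * T by rewrite Tn.
rewrite -[(5 * t ^+ 2)%:C *: h]mulr_algl -[(2 * t)%:C *: _]mulr_algl -!fC T3 T33 T52 T2 -/T -fX.
rewrite -!(rmorphM f, rmorphB f, rmorphD f).
by congr (f _); ring.
Qed.

(* With [t = |z|^2] and [h = w^2], the identity [z (t + h) = (t - z z* ) z] gives
   [(t + h) h (t + h) <= t^3]; with [h^2 >= 2 t h - t^2] this yields [5 t^2 h <= 3 t^3],
   whereas [|h| = t]. *)
Lemma neg_star_mul z w : star w = w -> star z * z = - (w * w) -> z = 0.
Proof.
move=> sw; have [h hE] : exists h, h = w * w by exists (w * w).
rewrite -hE => zw; set t := nrm z ^+ 2; set g := z * star z.
have t0 : 0 <= t by exact: sqr_ge0.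
have ph : psd h by rewrite hE; exact: psd_sq.
have sh : star h = h by case: ph.
have ht : nrm h = t by rewrite -nrmN -zw nrm_star_mul.
have gt : nrm g = t by rewrite /g -{1}(starK z) nrm_star_mul nrm_star.
have pg : psd g.
  have -> : g = (g + star z * z) + h by rewrite zw subrK.
  exact: psdD (psd_half_sum z) ph.
pose q := z * (scal t + h).
have qE : q = (scal t - g) * z.
  rewrite /q mulrDr mulrBl scal_comm; congr (_ + _).
  by rewrite -[h]opprK -zw mulrN mulrA.
pose b := (scal t + h) * h * (scal t + h).
have sth : star (scal t + h) = scal t + h by rewrite starD star_scal sh.
have sb : star b = b by rewrite /b !starM sth sh mulrA.
(* [star q * q = - b], while [qE] and [psd_dist] give [nrm q <= t * nrm z]. *)
have bt : nrm b <= t ^+ 3.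
  have -> : nrm b = nrm q ^+ 2.
    by rewrite -nrm_star_mul /q starM sth mulrA -[_ * star z * z]mulrA zw mulrN mulNr nrmN.
  rewrite (_ : t ^+ 3 = (t * nrm z) ^+ 2); last by rewrite exprMn -/t -exprSr.
  rewrite ler_sqr ?nnegrE ?mulr_ge0 ?nrm_ge0 // qE (le_trans (nrmM _ _)) //.
  by rewrite ler_wpM2r ?nrm_ge0 // psd_dist // gt.
have p1 := psd_scalB sb bt.
have p2 : psd ((2 * t)%:C *: ((h - scal t) * (h - scal t))).
  by apply: psdZ; [rewrite mulr_ge0 | apply: psd_sq; rewrite starB star_scal sh].
have p3 : psd (h * h * h).
  have -> : h * h * h = (w * w * w) * (w * w * w) by rewrite hE !mulrA.
  by apply: psd_sq; rewrite !starM sw mulrA.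
have p : psd (scal (3 * t ^+ 3) - (5 * t ^+ 2)%:C *: h).
  suff -> : scal (3 * t ^+ 3) - (5 * t ^+ 2)%:C *: h =
      (scal (t ^+ 3) - b) + ((2 * t)%:C *: ((h - scal t) * (h - scal t)) + h * h * h).
    exact: psdD p1 (psdD p2 p3).
  exact: neg_star_mul_identity.
have n3 : 0 <= 3 * t ^+ 3 by apply: mulr_ge0 => //; apply: exprn_ge0.
have n5 : 0 <= 5 * t ^+ 2 by apply: mulr_ge0 => //; apply: exprn_ge0.
have h5 := psd_bound n3 (psdZ n5 ph) p.
rewrite nrmZr ht ger0_norm // in h5.
have t_le0 : t <= 0.
  rewrite leNgt; apply/negP => tp.
  have : 0 < t ^+ 3 by rewrite exprn_gt0.
  by move: h5; rewrite -mulrA -exprSr; lra.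
apply/nrm_eq0/eqP; rewrite -sqrf_eq0 -/t; apply/eqP/le_anti.
by rewrite t_le0 t0.
Qed.

(* With [p = |y* y| - y* y], the element [z = y p] has [z* z <= 0], which forces [z = 0]. *)
Lemma psd_star_mul y : psd (star y * y).
Proof.
set h := star y * y.
have sh : star h = h by rewrite starM starK.
have [s [ps ss hs]] := sa_abs sh.
have [r [[sr _] rr rz]] := psd_sqrt ps.
have [sst _] := ps.
pose p := s - h.
have sp : star p = p by rewrite starB sst sh.
have rp : r * p = p * r.
  by rewrite mulrBr mulrBl -(rz h hs); congr (_ - _); rewrite -rr mulrA.
have hp : h * p = - (s * p) by rewrite !mulrBr opprB ss hs.
(* [star (y p) * (y p) = p h p = - (p s p)], and [p s p] is the square of the self-adjoint [r p]. *)
have z0 : y * p = 0.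
  apply: (@neg_star_mul _ (r * p)); first by rewrite starM sp sr rp.
  rewrite starM sp -mulrA [star y * _]mulrA -/h hp mulrN; congr (- _).
  by rewrite -rr -!mulrA [RHS]mulrA rp -mulrA.
have hp0 : h * p = 0 by rewrite /h -mulrA z0 mulr0.
(* [p^2 = s p - h p], and both terms vanish because [h p = - (s p) = 0]. *)
have pp : p * p = 0 by rewrite {1}/p mulrBl -[s * p]opprK -hp hp0 oppr0 addr0.
have : nrm p ^+ 2 = 0 by rewrite -nrm_sa_sq // pp nrm0.
move/eqP; rewrite sqrf_eq0 => /eqP/nrm_eq0/eqP; rewrite subr_eq0 => /eqP <-.
exact: ps.
Qed.

Lemma positiveP h : positive star h <-> psd h.
Proof.
split=> [[y ->]|]; first exact: psd_star_mul.
by move/psd_sqrt=> [r [[sr _] rr _]]; exists r; rewrite sr.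
Qed.

(** Put [p = s - h]. By commutation [p s p + p h p = (s^2 - h^2) p = 0]; both summands are positive,
    so each vanishes and [p^3 = 0], whence [p = 0] by the C*-identity. *)
Lemma psd_sqrt_unique s h : psd s -> psd h -> s * h = h * s -> s * s = h * h -> s = h.
Proof.
move=> ps ph sh ss.
have [r [[sr _] rr rz]] := psd_sqrt ps.
have [k [[sk _] kk kz]] := psd_sqrt ph.
have [[sst _] [sht _]] := (ps, ph).
pose p := s - h.
have sp : star p = p by rewrite starB sst sht.
have psp : p * s * p = star (r * p) * (r * p).
  by rewrite starM sr sp -rr !mulrA.
have php : p * h * p = star (k * p) * (k * p).
  by rewrite starM sk sp -kk !mulrA.
have sum0 : p * s * p + p * h * p = 0.
  by rewrite -mulrDl -mulrDr {1}/p mulrDr !mulrBl ss sh addrA subrK subrr mul0r.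
have psp0 : p * s * p = 0.
  apply: psd_anti; first by rewrite psp; exact: psd_star_mul.
  move/eqP: (sum0); rewrite addrC addr_eq0 => /eqP <-.
  by rewrite php; exact: psd_star_mul.
have php0 : p * h * p = 0 by rewrite psp0 add0r in sum0.
have ppp : p * (s - h) * p = 0 by rewrite (mulrBr p s h) (mulrBl p) psp0 php0 subrr.
have spp : star (p * p) = p * p by rewrite starM sp.
have : nrm p ^+ 2 ^+ 2 = 0.
  by rewrite -nrm_sa_sq // -nrm_sa_sq // mulrA ppp mul0r nrm0.
move/eqP; rewrite !sqrf_eq0 => /eqP/nrm_eq0/eqP; rewrite subr_eq0 => /eqP //.
Qed.

End CStarPositive.

(** * Regular completions as order completions *)

Section Completion.
Import Order.TTheory GRing.Theory Num.Theory.
Local Open Scope ring_scope.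
Local Open Scope complex_scope.

(** * The order on the self-adjoint part *)

Section Order.
Variables (R : realType) (A : algType R[i]) (star : A -> A) (nrm : A -> R).
Hypothesis cs : is_cstar star nrm.

Lemma le_saP x y : le_sa star x y <-> psd star nrm (y - x).
Proof. exact: positiveP cs _. Qed.

Lemma le_sa_refl x : le_sa star x x.
Proof. by exists 0; rewrite subrr mulr0. Qed.

Lemma le_sa_trans x y z : le_sa star x y -> le_sa star y z -> le_sa star x z.
Proof.
move=> /le_saP xy /le_saP yz; apply/le_saP.
have -> : z - x = (z - y) + (y - x) by rewrite addrA subrK.
exact: (psdD cs yz xy).
Qed.

Lemma le_sa_anti x y : le_sa star x y -> le_sa star y x -> x = y.
Proof.
move=> /le_saP xy /le_saP yx; apply/eqP; rewrite -subr_eq0; apply/eqP.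
by apply: (psd_anti cs yx); rewrite opprB.
Qed.

Lemma le_saN x y : le_sa star (- x) (- y) <-> le_sa star y x.
Proof. by rewrite /le_sa opprK addrC. Qed.

Lemma le_sa_oppl x y : le_sa star (- x) y <-> le_sa star (- y) x.
Proof. by rewrite /le_sa !opprK addrC. Qed.

Lemma le_sa_oppr x y : le_sa star x (- y) <-> le_sa star y (- x).
Proof. by rewrite /le_sa addrC. Qed.

Lemma le_sa_nrm b t : star b = b -> nrm b <= t -> le_sa star b (t%:C%:A).
Proof. by move=> sb bt; apply/le_saP; exact: psd_scalB. Qed.

Lemma le_sa_Nnrm b t : star b = b -> nrm b <= t -> le_sa star (- t%:C%:A) b.
Proof.
move=> sb bt; apply/le_sa_oppl/le_sa_nrm; first by rewrite (starN cs) sb.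
by rewrite (nrmN cs).
Qed.

Lemma Sa_inj (x y : Sa star) : sval x = sval y -> x = y.
Proof. by case: x y => [x sx] [y sy] /= xy; exact: eq_exist. Qed.

Definition leS (x y : Sa star) : Prop := le_sa star (sval x) (sval y).

Definition oppS (x : Sa star) : Sa star :=
  exist _ (- sval x) (etrans (starN cs _) (congr1 -%R (svalP x))).

Lemma ge_leS_opp x y : flip leS x y <-> leS (oppS x) (oppS y).
Proof. by split=> /le_saN. Qed.

Lemma oppSK x : oppS (oppS x) = x.
Proof. by apply: Sa_inj; rewrite /= opprK. Qed.

Lemma is_sup_lub D (x : D -> A) (s : A) (x' : D -> Sa star) (s' : Sa star) :
  (forall j, sval (x' j) = x j) -> sval s' = s -> is_sup star (range_net x) s -> lub leS x' s'.
Proof.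
move=> xE sE [_ xs s_min]; split=> [j|u xu]; rewrite /leS sE.
  by rewrite xE; apply: xs; exists j.
by apply: s_min => [|_ [j ->]]; [exact: svalP u | rewrite -xE; exact: xu].
Qed.

Lemma is_inf_glb D (x : D -> A) (s : A) (x' : D -> Sa star) (s' : Sa star) :
  (forall j, sval (x' j) = x j) -> sval s' = s -> is_inf star (range_net x) s ->
  lub (flip leS) x' s'.
Proof.
move=> xE sE [_ xs s_min]; split=> [j|u xu]; rewrite /flip /leS sE.
  by rewrite xE; apply: xs; exists j.
by apply: s_min => [|_ [j ->]]; [exact: svalP u | rewrite -xE; exact: xu].
Qed.

Lemma leS_complete : monotone_complete star -> forall D leD (x : D -> Sa star),
  bounded_monotone leS leD x -> exists s, lub leS x s.
Proof.
move=> mc D leD x [dirD [l [u lxu]] mono_x].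
have [|s xs] := mc D leD (fun j => sval (x j)).
  split=> //; split=> [j|]; first exact: svalP (x j).
  (* [bounded_sa_net] asks for symmetric bounds [- c] and [c]; this scalar dominates [u], and its
     opposite lies below [l]. *)
  pose t := nrm (sval l) + nrm (sval u).
  exists t%:C%:A; split=> [|j]; first exact: star_scal cs _.
  have [lj ju] := lxu j; split.
    apply: le_sa_trans lj; apply: le_sa_Nnrm; first exact: svalP l.
    by rewrite lerDl (nrm_ge0 cs).
  apply: le_sa_trans ju _; apply: le_sa_nrm; first exact: svalP u.
  by rewrite lerDr (nrm_ge0 cs).
have [ss _ _] := xs.
by exists (exist _ s ss); exact: is_sup_lub xs.
Qed.

Lemma leS_complete_flip : monotone_complete star -> forall D leD (x : D -> Sa star),
  bounded_monotone (flip leS) leD x -> exists s, lub (flip leS) x s.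
Proof.
move=> mc D leD x [dirD [l [u lxu]] mono_x].
have [|s [xs s_min]] := leS_complete mc (leD := leD) (x := fun j => oppS (x j)).
  split=> // [|j k jk]; last exact/(proj1 (ge_leS_opp _ _))/mono_x.
  by exists (oppS l), (oppS u) => j; have [lj ju] := lxu j; split; apply/(proj1 (ge_leS_opp _ _)).
exists (oppS s); split=> [j|v xv]; apply/(proj2 (ge_leS_opp _ _)); rewrite oppSK //.
by apply: s_min => j; exact/(proj1 (ge_leS_opp _ _))/xv.
Qed.

End Order.

(** * Unital star-monomorphisms are order embeddings *)

Section StarMono.
Variables (R : realType) (A B : algType R[i]) (stA : A -> A) (stB : B -> B).
Variables (nA : A -> R) (nB : B -> R) (iA : A -> B).
Hypotheses (csA : is_cstar stA nA) (csB : is_cstar stB nB).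
Hypothesis iA_mono : unital_star_mono stA stB iA.

Lemma star_mono0 : iA 0 = 0.
Proof.
case: iA_mono => _ lin _ _ _; have := lin 1 0 0.
by rewrite !scale1r addr0 => /eqP; rewrite -subr_eq0 opprD addrA subrr sub0r oppr_eq0 => /eqP.
Qed.

Lemma star_monoZ c x : iA (c *: x) = c *: iA x.
Proof. by case: iA_mono => _ lin _ _ _; have := lin c x 0; rewrite star_mono0 !addr0. Qed.

Lemma star_monoN x : iA (- x) = - iA x.
Proof. by rewrite -scaleN1r star_monoZ scaleN1r. Qed.

Lemma star_monoB x y : iA (x - y) = iA x - iA y.
Proof.
case: iA_mono => _ lin _ _ _; have := lin 1 x (- y).
by rewrite !scale1r star_monoN.
Qed.

Lemma star_mono_sa x : stA x = x -> stB (iA x) = iA x.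
Proof. by case: iA_mono => _ _ _ _ st sx; rewrite -st sx. Qed.

Lemma star_mono_psd x : psd stA nA x -> psd stB nB (iA x).
Proof.
move=> /(psd_sqrt csA)[r [[sr _] <- _]]; have [_ _ mul _ _] := iA_mono.
by rewrite mul; apply: psd_sq csB _ _; exact: star_mono_sa.
Qed.

(** The images of [x] and of its absolute value [s] are commuting positive elements with the same
    square, hence equal; injectivity gives [x = s]. *)
Lemma star_mono_psdE x : stA x = x -> psd stB nB (iA x) -> psd stA nA x.
Proof.
move=> sx px; have [s [ps ss xs]] := sa_abs csA sx.
have [inj _ mul _ _] := iA_mono.
suff <- : s = x by [].
apply: inj; apply: (psd_sqrt_unique csB (star_mono_psd ps) px); by rewrite -!mul ?ss ?xs.
Qed.

Lemma star_mono_le x y : stA x = x -> stA y = y ->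
  le_sa stB (iA x) (iA y) <-> le_sa stA x y.
Proof.
move=> sx sy; split=> [/(le_saP csB)|/(le_saP csA)] h.
  apply/(le_saP csA)/star_mono_psdE; first by rewrite (starB csA) sx sy.
  by rewrite star_monoB.
by apply/(le_saP csB); rewrite -star_monoB; exact: star_mono_psd.
Qed.

End StarMono.

Lemma regular_order_completion (R : realType) (A Ab : algType R[i])
    (starA : A -> A) (starAb : Ab -> Ab) (nA : A -> R) (nAb : Ab -> R) (iA : A -> Ab) :
  is_cstar starA nA -> regular_monotone_completion starA starAb nAb iA ->
  exists i : Sa starA -> Sa starAb,
    [/\ forall a, sval (i a) = iA (sval a), forall a b, leS (i a) (i b) <-> leS a b &
        order_completion (@leS R Ab starAb) i].
Proof.
move=> csA [[csAb mc] iA_mono gen dense _].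
have iAsa := star_mono_sa iA_mono.
pose i (a : Sa starA) : Sa starAb := exist _ (iA (sval a)) (iAsa _ (svalP a)).
have iZ t : iA (t%:C%:A) = t%:C%:A.
  by rewrite (star_monoZ iA_mono); case: iA_mono => _ _ _ -> _.
pose sc (t : R) : Sa starA := exist _ (t%:C%:A) (star_scal csA t).
have denseL (b c : Sa starAb) : (forall a, leS (i a) b -> leS (i a) c) -> leS b c.
  move=> h; have [_ _ s_min] := dense _ (svalP b); apply: s_min (svalP c) _.
  by move=> _ [a [sa -> ab]]; exact: (h (exist _ a sa)).
exists i; split=> //.
  by move=> a b; exact: (star_mono_le csA csAb iA_mono (svalP a) (svalP b)).
split.
- split=> //.
  + by move=> b; exact: le_sa_refl.
  + by move=> b c bc cb; apply: Sa_inj; exact: (le_sa_anti csAb bc cb).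
  + by move=> b c d; exact: (le_sa_trans csAb).
  + move=> b; exists (sc (nAb (sval b))); rewrite /leS /= iZ.
    exact: (le_sa_nrm csAb (svalP b)).
  + by move=> D leD x; exact: (leS_complete csAb).
- split; rewrite /flip.
  + by move=> b; exact: le_sa_refl.
  + by move=> b c bc cb; apply: Sa_inj; exact: (le_sa_anti csAb cb bc).
  + by move=> b c d bc cd; exact: (le_sa_trans csAb cd bc).
  (* Density from above is density from below after negation, which commutes with [i]. *)
  + move=> b c h; apply/(proj2 (ge_leS_opp csAb _ _))/denseL => a /= ab.
    have iN : i (oppS csA a) = oppS csAb (i a).
      by apply: Sa_inj; rewrite /= (star_monoN iA_mono).
    by apply/le_sa_oppr; have := h (oppS csA a); rewrite iN; apply; exact/le_sa_oppr.
  + move=> b; exists (oppS csA (sc (nAb (sval b)))); rewrite /leS /= (star_monoN iA_mono) iZ.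
    exact: (le_sa_Nnrm csAb (svalP b)).
  + by move=> D leD x; exact: (leS_complete_flip csAb).
- move=> S Si Ssup Sinf b.
  (* [monotone_closure] ranges over predicates on [Ab], so [S] is first pushed forward from the
     subtype. *)
  have [b' [/Sa_inj <- //]] : exists b', sval b' = sval b /\ S b'.
  apply: (gen _ (svalP b) (fun y => exists b', sval b' = y /\ S b')).
    by move=> _ [a [sa ->]]; exists (i (exist _ a sa)).
  split=> D leD x [dirD [x_sa [c [sc' xc]]] mono_x] Sx s xs;
    have [y yP] := choice Sx; have yx j := (yP j).1; have Sy j := (yP j).2.
    have [ss _ _] := xs; exists (exist _ s ss); split=> //.
    apply: (Ssup _ leD y) => //; last exact: is_sup_lub xs.
    split=> //; last by move=> j k jk; rewrite /leS !yx; exact: mono_x.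
    exists (oppS csAb (exist _ c sc')), (exist _ c sc').
    by move=> j; rewrite /leS yx; exact: xc.
  have [ss _ _] := xs; exists (exist _ s ss); split=> //.
  apply: (Sinf _ leD y) => //; last exact: is_inf_glb xs.
  split=> //; last by move=> j k jk; rewrite /flip /leS !yx; exact: mono_x.
  exists (exist _ c sc'), (oppS csAb (exist _ c sc')).
  by move=> j; rewrite /flip /leS yx; have [] := xc j.
Qed.

End Completion.

Theorem theorem3p5 (R : realType)
    (A : algType R[i]) (starA : A -> A) (nA : A -> R)
    (B : algType R[i]) (starB : B -> B) (nB : B -> R)
    (Ab : algType R[i]) (starAb : Ab -> Ab) (nAb : Ab -> R) (iA : A -> Ab)
    (Bb : algType R[i]) (starBb : Bb -> Bb) (nBb : Bb -> R) (iB : B -> Bb) :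
  is_cstar starA nA -> is_cstar starB nB ->
  regular_monotone_completion starA starAb nAb iA ->
  regular_monotone_completion starB starBb nBb iB ->
  forall Phi : Sa starA -> Sa starB, order_iso Phi ->
  exists Phib : Sa starAb -> Sa starBb,
    [/\ order_iso Phib, extends iA iB Phi Phib &
        forall Psi : Sa starAb -> Sa starBb,
          order_iso Psi -> extends iA iB Phi Psi -> Psi = Phib].
Proof.
move=> csA csB rA rB Phi [bijPhi monoPhi].
have [i [iE i_le oA]] := regular_order_completion csA rA.
have [j [jE j_le oB]] := regular_order_completion csB rB.
have [f [bijf f_le fi f_uniq]] :
  exists f : Sa starAb -> Sa starBb,
    [/\ bijective f, (forall b c, leS b c <-> leS (f b) (f c)), (forall a, f (i a) = j (Phi a)) &
        forall g : Sa starAb -> Sa starBb, (forall b c, leS b c <-> leS (g b) (g c)) ->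
          (forall a, g (i a) = j (Phi a)) -> g = f].
  (* Through [Phi], the completion of [B] becomes a second completion of [Sa starA]. *)
  apply: order_completion_unique oA (order_completion_comp bijPhi oB).
  by move=> a b; rewrite i_le j_le; exact: monoPhi.
exists f; split=> //.
- move=> a b ba; have -> : b = i a by apply: Sa_inj; rewrite iE.
  by rewrite fi jE.
- move=> Psi [_ Psi_le] PsiE; apply: f_uniq => // a.
  by apply: Sa_inj; rewrite jE; apply: PsiE; rewrite iE.
Qed.
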